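(* Let $G$ be a graph with $\alpha(G)=2$ whose edges are colored with two colors. Suppose that there is a vertex $v\in V(G)$ such that $V(G)\setminus\{v\}$ is the union of the vertex sets of two vertex-disjoint complete subgraphs $K'$ and $K''$ of $G$, and $v$ is adjacent to all but one vertex of $K'$ and to all but one vertex of $K''$. Then $G$ has a $(3,3)$-cover; that is, $V(G)$ can be covered by the vertex sets of two monochromatic subgraphs of $G$, each of diameter at most $3$.
   Context: Graphs are finite and simple; $\alpha(G)$ is the independence number. A monochromatic subgraph is a subgraph (not necessarily induced) all of whose edges have the same color; a single vertex counts as a monochromatic subgraph. The diameter of a graph $H$ is the smallest integer $d$ with $d_H(u,v)\le d$ for all $u,v\in V(H)$, where distances are measured in $H$ itself ($\infty$ if there is no path); a one-vertex graph has diameter $0$. A 2-colored graph $G$ has a $(p,q)$-cover if $V(G)$ is the union of the vertex sets of two monochromatic subgraphs of $G$, one of diameter at most $p$ and the other of diameter at most $q$; the two subgraphs may have the same or different colors and their vertex sets may overlap. *)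

(* Defs.v *)
From mathcomp Require Import all_boot.

Set Implicit Arguments.
Unset Strict Implicit.
Unset Printing Implicit Defensive.

Record sgraph := SGraph {
  vertex :> finType;
  adj : rel vertex;
  adj_sym : symmetric adj;
  adj_irr : irreflexive adj }.

Section Graph.
Variable G : sgraph.

Definition independent (S : {set G}) : bool :=
  [forall x in S, forall y in S, ~~ adj x y].

Definition independence_number : nat :=
  \max_(S : {set G} | independent S) #|S|.

Definition clique (K : {set G}) : Prop :=
  {in K &, forall x y, x != y -> adj x y}.

(* Not necessarily induced. As usual, a graph has at least one vertex. *)
Record subgraph := Subgraph {
  sub_vert : {set G};
  sub_adj : rel G;
  sub_vert_neq0 : sub_vert != set0;
  sub_adj_sym : symmetric sub_adj;
  sub_adjP : forall x y, sub_adj x y ->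
    [/\ x \in sub_vert, y \in sub_vert & adj x y] }.

(* d_H(u, v) <= d. *)
Definition dist_le (H : subgraph) (u v : G) (d : nat) : Prop :=
  exists p : seq G,
    [/\ path (sub_adj H) u p, last u p = v & size p <= d].

Definition dists_le (H : subgraph) (d : nat) : Prop :=
  {in sub_vert H &, forall u v, dist_le H u v d}.

(* A disconnected H has no (finite) diameter. *)
Definition is_diameter (H : subgraph) (d : nat) : Prop :=
  dists_le H d /\ forall d', dists_le H d' -> d <= d'.

Definition diameter_le (H : subgraph) (p : nat) : Prop :=
  exists2 d, is_diameter H d & d <= p.

(* The edge xy is the set [set x; y]; the values of a coloring on sets that
   are not edges of G are never used. *)
Definition coloring := {set G} -> bool.

Definition monochromatic (c : coloring) (H : subgraph) : Prop :=
  exists b : bool, forall x y, sub_adj H x y -> c [set x; y] = b.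

Definition has_cover (c : coloring) (p q : nat) : Prop :=
  exists H1 H2 : subgraph,
    [/\ monochromatic c H1, monochromatic c H2,
        diameter_le H1 p, diameter_le H2 q
      & sub_vert H1 :|: sub_vert H2 = [set: G]].

End Graph.

(* Main.v *)
Require Import Defs.
From mathcomp Require Import all_boot.

(** Let [x] and [y] be the vertices of [K'] and [K''] not adjacent to [v], and
    put [A = K' - x], [B = K'' - y]; since [alpha(G) = 2], [xy] is an edge.  A
    2-colored complete graph is spanned by a monochromatic subgraph of diameter
    at most 3: two vertices at red distance more than 2 are the centers of a
    spanning blue double star.  The same holds for the almost complete graph on
    [A + v + x], unless all edges from [v] to [A] have one color and all edges
    from [x] to [A] the other one.  So we are done unless both [A + v + x] and
    [B + v + y] are such exceptions, and then [V(G)] is the union of two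
    monochromatic stars. *)

Set Implicit Arguments.
Unset Strict Implicit.
Unset Printing Implicit Defensive.

(** * Walks of length at most 3 in a reflexive symmetric relation *)

Section Walks.
Variable T : finType.
Implicit Types (e : rel T) (S : {set T}).

Definition loops e : rel T := fun p q => (p == q) || e p q.

(* Relations are made reflexive, so that walks of length exactly [n] also
   account for the shorter ones. *)
Fixpoint walk e n p q :=
  if n is n'.+1 then [exists z, e p z && walk e n' z q] else p == q.

Lemma walk_loopsP e n p q :
  reflect (exists s, [/\ path e p s, last p s = q & size s <= n])
          (walk (loops e) n p q).
Proof.
elim: n p => [|n IHn] p /=.
  apply: (iffP eqP) => [->|[[|z s] [] //]]; by exists [::].
apply: (iffP existsP) => [[z /andP[/orP[/eqP<-|epz] /IHn[s [es ls ss]]]]|].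
- by exists s; split=> //; apply: leqW.
- by exists (z :: s) => /=; rewrite epz.
case=> [[|z s] [/= es ls ss]].
  by exists p; rewrite /loops eqxx; apply/IHn; exists [::].
case/andP: es => epz es; exists z; rewrite /loops epz orbT.
by apply/IHn; exists s.
Qed.

Lemma walk3 z t e p q : e p z -> e z t -> e t q -> walk e 3 p q.
Proof.
move=> epz ezt etq; apply/existsP; exists z; rewrite epz /=.
apply/existsP; exists t; rewrite ezt /=.
by apply/existsP; exists q; rewrite etq eqxx.
Qed.

Definition spans3 e S := [forall p in S, forall q in S, walk e 3 p q].

Lemma spans3P e S : reflect {in S &, forall p q, walk e 3 p q} (spans3 e S).
Proof.
apply: (iffP 'forall_in_forall_inP) => He p; first by move=> q /He; apply.
by move=> pS q; apply: He.
Qed.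

Lemma spans3Pn e S :
  ~~ spans3 e S -> exists p q, [/\ p \in S, q \in S & ~~ walk e 3 p q].
Proof.
rewrite negb_forall_in => /exists_inP[p pS]; rewrite negb_forall_in.
by case/exists_inP=> q qS pq; exists p, q.
Qed.

Arguments walk3 z t {e p q}.

Lemma walk3_sym e p q : symmetric e -> walk e 3 p q -> walk e 3 q p.
Proof.
move=> es /existsP[z /andP[epz /existsP[t /andP[ezt /existsP[w /andP[etw]]]]]].
by move=> /eqP<-; apply: (walk3 t z); rewrite es.
Qed.

(** Walks between leaves pass through the centers, with loops as padding. The centers may coincide,
    which gives stars. *)
Lemma double_star_spans3 e S u w :
    reflexive e -> symmetric e -> e u w ->
  {in S, forall z, e u z || e w z} -> spans3 e S.
Proof.
move=> er es euw H; apply/spans3P => p q /H Hp /H Hq.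
case/orP: Hp => Hp; case/orP: Hq => Hq.
- by apply: (walk3 u u) => //; rewrite es.
- by apply: (walk3 u w) => //; rewrite es.
- by apply: (walk3 w u) => //; rewrite es.
- by apply: (walk3 w w) => //; rewrite es.
Qed.

(** Two vertices of [A] share the neighbor [v], or share [x], or one misses [x] and the other misses
    [v], and then they are related. The vertices [a] and [a'] attach [v] and [x] to [A]. *)
Lemma bridged_spans3 e (A : {set T}) v x a a' :
    reflexive e -> symmetric e -> a \in A -> a' \in A -> e v a -> e x a' ->
    {in A, forall z, e v z || e x z} ->
    {in A &, forall z t, ~~ e x z -> ~~ e v t -> e z t} ->
  spans3 e ([set v; x] :|: A).
Proof.
move=> er es aA a'A eva exa' evx cross.
have dvx : walk e 3 v x.
  have [exa|nxa] := boolP (e x a).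
    by apply: (walk3 v a) => //; rewrite es.
  have [eva'|nva'] := boolP (e v a').
    by apply: (walk3 v a') => //; rewrite es.
  by apply: (walk3 a a') => //; [apply: cross | rewrite es].
have dv z : z \in A -> walk e 3 v z.
  move=> zA; have [evz|nvz] := boolP (e v z); first exact: (walk3 v v).
  have [exa|nxa] := boolP (e x a); last first.
    by apply: (walk3 v a) => //; apply: cross.
  have := evx z zA; rewrite (negPf nvz) /= => exz.
  by apply: (walk3 a x) => //; rewrite es.
have dx z : z \in A -> walk e 3 x z.
  move=> zA; have [exz|nxz] := boolP (e x z); first exact: (walk3 x x).
  have [eva'|nva'] := boolP (e v a'); last first.
    by apply: (walk3 x a') => //; rewrite es; apply: cross.
  have := evx z zA; rewrite (negPf nxz) orbF => evz.
  by apply: (walk3 a' v) => //; rewrite es.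
have dA z t : z \in A -> t \in A -> walk e 3 z t.
  move=> zA tA; have := evx z zA; have := evx t tA.
  have [exz|nxz] := boolP (e x z); have [evt|nvt] := boolP (e v t) => /=.
  - move=> _ _; have [evz|nvz] := boolP (e v z).
      by apply: (walk3 v v); rewrite // es.
    have [ext|nxt] := boolP (e x t); first by apply: (walk3 x x); rewrite // es.
    by apply: (walk3 z z) => //; rewrite es; apply: cross.
  - by move=> ext _; apply: (walk3 x x); rewrite // es.
  - by rewrite orbF => _ evz; apply: (walk3 v v); rewrite // es.
  - by move=> _ _; apply: (walk3 z z); rewrite // cross.
apply/spans3P => p q; rewrite !inE -!orbA.
have d0 z : walk e 3 z z by apply: (walk3 z z).
by case/or3P=> [/eqP->|/eqP->|pA]; case/or3P=> [/eqP->|/eqP->|qA];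
  auto; apply: walk3_sym => //; auto.
Qed.

End Walks.

Arguments walk3 {T} z t {e p q}.

(** * Pairs of relations that together cover all, or almost all, pairs of vertices *)

Section TwoRelations.
Variables (T : finType) (e : bool -> rel T).
Hypothesis er : forall b, reflexive (e b).
Hypothesis es : forall b, symmetric (e b).
Implicit Types (b : bool) (S A : {set T}).

#[local] Hint Extern 0 (is_true (e _ _ _)) => apply: er : core.

Let tot p q := e true p q || e false p q.

Lemma tot_neg b p q : tot p q -> ~~ e b p q -> e (~~ b) p q.
Proof. by rewrite /tot; case: b; case: (e true p q); case: (e false p q). Qed.

(** Only pairs containing [p] or [q] have to be related, so the double star argument also works
    where [S] is not complete. *)
Lemma spans3_of_far b S p q :
    ~~ walk (e b) 3 p q -> tot p q ->
    {in S, forall z, tot p z /\ tot q z} ->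
  spans3 (e (~~ b)) S.
Proof.
move=> far tpq tS; apply: (@double_star_spans3 _ _ _ p q) => //.
  by apply: tot_neg => //; apply: contra far => epq; apply: (walk3 p q).
move=> z /tS[tp tq]; have [epz|/(tot_neg tp)-> //] := boolP (e b p z).
rewrite (@tot_neg b q z) ?orbT //; apply: contra far => eqz.
by apply: (walk3 z q) => //; rewrite es.
Qed.

Lemma spans3_complete S :
  {in S &, forall p q, tot p q} -> exists b, spans3 (e b) S.
Proof.
move=> tS; have [|/spans3Pn[p [q [pS qS far]]]] := boolP (spans3 (e true) S).
  by exists true.
exists false; apply: (spans3_of_far far); first exact: tS.
by move=> z zS; split; apply: tS.
Qed.

(** The exceptional pattern: for a coloring with [v] and [x] distinct, nonadjacent and outside [A],
    it isolates [x] in color [b] and [v] in the other color. *)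
Definition opposite b v x A := [forall a in A, e b v a && e (~~ b) x a].

(** * A complete set with two extra vertices *)

Section AlmostComplete.
Variable A : {set T}.
Hypothesis tA : {in A &, forall p q, tot p q}.

(** The pair [v], [x] is left free: in the application it is a non-edge. *)
Definition almost v x :=
  {in A, forall a, tot v a} /\ {in A, forall a, tot x a}.

(** No short [b]-walk from [v] to [x] means that [~~ b] satisfies the domination and crossing
    conditions of [bridged_spans3]. Failure of the two patterns supplies [a] and [a']. *)
Lemma spans3_of_far_ends b v x : almost v x -> ~~ walk (e b) 3 v x ->
    ~~ opposite b v x A -> ~~ opposite (~~ b) v x A ->
  spans3 (e (~~ b)) ([set v; x] :|: A).
Proof.
move=> [tv tx] far; rewrite !negb_forall_in.
case/exists_inP=> a aA no /exists_inP[a' a'A no']; rewrite negbK in no'.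
have fvx z : z \in A -> e (~~ b) v z || e (~~ b) x z.
  move=> zA; have [evz|/(tot_neg (tv z zA))-> //] := boolP (e b v z).
  rewrite (tot_neg (tx z zA)) ?orbT //; apply: contra far => exz.
  by apply: (walk3 z x) => //; rewrite es.
apply: (@bridged_spans3 _ _ _ _ _ a a') => // [||z t zA tA' nxz nvt].
- have [eva|/(tot_neg (tv a aA))-> //] := boolP (e b v a).
  by have := fvx a aA; rewrite eva /= in no; rewrite (negPf no) orbF.
- have [exa|/(tot_neg (tx a' a'A))-> //] := boolP (e b x a').
  by have := fvx a' a'A; rewrite exa andbT in no'; rewrite (negPf no').
- apply: tot_neg; first exact: tA.
  have exz : e b x z by apply: contraNT nxz; apply: tot_neg; apply: tx.
  have evt : e b v t by apply: contraNT nvt; apply: tot_neg; apply: tv.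
  by apply: contra far => ezt; apply: (walk3 t z) => //; rewrite es.
Qed.

(** Otherwise [x] would also be a leaf of the [~~ b] double star centered at [v] and [w], which
    would then span. *)
Lemma far_other_end b v x w : almost v x -> w \in A ->
    ~~ walk (e b) 3 v w -> ~~ spans3 (e (~~ b)) ([set v; x] :|: A) ->
  e b x w.
Proof.
move=> [tv tx] wA far; apply: contraNT => nxw.
have fxw := tot_neg (tx w wA) nxw.
apply: (@double_star_spans3 _ _ _ v w) => // [|z].
  by apply: tot_neg (tv w wA) _; apply: contra far => evw; apply: (walk3 v v).
rewrite !inE -orbA => /or3P[/eqP->|/eqP->|zA]; first by rewrite er.
  by rewrite (es _ w) fxw orbT.
have [evz|/(tot_neg (tv z zA))-> //] := boolP (e b v z).
rewrite (tot_neg (tA wA zA)) ?orbT //; apply: contra far => ewz.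
by apply: (walk3 v z) => //; rewrite es.
Qed.

(** A [b]-edge from [v] to [w'] forces [w w'] into [~~ b], so [w] is a detour. Hence [v] cannot be
    far from vertices of [A] in both colors. *)
Lemma far_same_end b v w w' : w \in A -> w' \in A ->
    tot v w -> tot v w' ->
  ~~ walk (e b) 3 v w -> walk (e (~~ b)) 3 v w'.
Proof.
move=> wA w'A tvw tvw' far.
have fvw : e (~~ b) v w.
  by apply: tot_neg tvw _; apply: contra far => evw; apply: (walk3 v v).
have [evw'|/(tot_neg tvw') fvw'] := boolP (e b v w'); last exact: (walk3 v v).
apply: (walk3 v w) => //; apply: tot_neg; first exact: tA.
by apply: contra far => eww'; apply: (walk3 v w') => //; rewrite es.
Qed.

(** A vertex [z] cannot have [b]-edges to both ends, by the walk [v], [z], [x], [w], nor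
    [~~ b]-edges to both, by [x], [z], [v], [w']. *)
Lemma far_distinct_ends b v x w w' : almost v x -> w \in A -> w' \in A ->
    ~~ walk (e b) 3 v w -> ~~ walk (e (~~ b)) 3 x w' ->
    e b x w -> e (~~ b) v w' ->
  opposite (~~ b) v x A.
Proof.
move=> [tv tx] wA w'A far far' exw fvw'; apply/forall_inP => z zA; rewrite negbK.
have nR : ~~ (e b v z && e b x z).
  by apply: contra far => /andP[evz exz]; apply: (walk3 z x) => //; rewrite es.
have nB : ~~ (e (~~ b) v z && e (~~ b) x z).
  by apply: contra far' => /andP[fvz fxz]; apply: (walk3 z v) => //; rewrite es.
have [evz|nvz] := boolP (e b v z); last first.
  have fvz := tot_neg (tv z zA) nvz; rewrite fvz /= in nB *.
  by apply: contraNT nB; apply: tot_neg; apply: tx.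
(* The wrong assignment at [z] forces [z w] into [~~ b] and [z w'] into [b]; either color of [w w']
   then completes a forbidden walk. *)
have fxz : e (~~ b) x z by apply: tot_neg (tx z zA) _; rewrite evz in nR.
have fzw : e (~~ b) z w.
  by apply: tot_neg (tA zA wA) _; apply: contra far => ezw; apply: (walk3 v z).
have ezw' : e b z w'.
  rewrite -[b]negbK; apply: tot_neg (tA zA w'A) _.
  by apply: contra far' => fzw'; apply: (walk3 x z).
have [eww'|/(tot_neg (tA wA w'A)) fww'] := boolP (e b w w').
  by case/negP: far; apply: (walk3 z w') => //; rewrite es.
by case/negP: far'; apply: (walk3 z w).
Qed.

(** If both colors fail to span and no pattern occurs, each color has a far pair, which must join
    [v] or [x] to [A]. The same end in both colors is impossible, and different ends force a
    pattern. *)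
Lemma spans3_almost_complete v x : almost v x ->
  (exists b, spans3 (e b) ([set v; x] :|: A)) \/ (exists b, opposite b v x A).
Proof.
set W := _ :|: A => tvx; have [tv tx] := tvx.
have txv : almost x v by split.
have Wvx : [set x; v] :|: A = W by rewrite [[set x; v]]setUC.
have [oT|nT] := boolP (opposite true v x A); first by right; exists true.
have [oF|nF] := boolP (opposite false v x A); first by right; exists false.
left; have [sT|sT] := boolP (spans3 (e true) W); first by exists true.
have [sF|sF] := boolP (spans3 (e false) W); first by exists false.
have nS b : ~~ spans3 (e b) W by case: b.
have nO b : ~~ opposite b v x A by case: b.
have far b : exists2 w, w \in A & ~~ walk (e b) 3 v w || ~~ walk (e b) 3 x w.
  have [p [q [pW qW npq]]] := spans3Pn (nS b).
  have d0 z : walk (e b) 3 z z by apply: (walk3 z z).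
  have dvx : walk (e b) 3 v x.
    by apply: contraNT (nS (~~ b)) => /spans3_of_far_ends; apply.
  have dsym z t : ~~ walk (e b) 3 z t -> ~~ walk (e b) 3 t z.
    by apply: contra; apply: walk3_sym.
  move: pW qW; rewrite !inE -!orbA.
  case/or3P=> [/eqP pE|/eqP pE|pA]; case/or3P=> [/eqP qE|/eqP qE|qA];
    rewrite ?pE ?qE in npq.
  - by rewrite d0 in npq.
  - by rewrite dvx in npq.
  - by exists q; rewrite // npq.
  - by rewrite (walk3_sym _ dvx) in npq.
  - by rewrite d0 in npq.
  - by exists q; rewrite // npq orbT.
  - by exists p; rewrite // dsym.
  - by exists p; rewrite // orbC dsym.
  - case/negP: (nS (~~ b)); apply: (spans3_of_far npq); first exact: tA.
    move=> z; rewrite !inE -orbA => /or3P[/eqP->|/eqP->|zA]; last by split; apply: tA.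
      by split; rewrite /tot es (es false); apply: tv.
    by split; rewrite /tot es (es false); apply: tx.
have [w wA /orP[fw|fw]] := far true; have [w' w'A /orP[fw'|fw']] := far false.
- by rewrite (far_same_end wA w'A (tv w wA) (tv w' w'A) fw) in fw'.
- case/negP: nF; apply: (far_distinct_ends tvx wA w'A fw fw').
    exact: (far_other_end tvx wA fw).
  by apply: (far_other_end txv w'A fw'); rewrite Wvx.
- case/negP: nT; apply: (far_distinct_ends (b := false) tvx w'A wA fw' fw).
    exact: (far_other_end tvx w'A fw').
  by apply: (far_other_end txv wA fw); rewrite Wvx.
- by rewrite (far_same_end wA w'A (tx w wA) (tx w' w'A) fw) in fw'.
Qed.

End AlmostComplete.
End TwoRelations.

(** * From relations to monochromatic subgraphs and covers *)

Section Coloring.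
Variables (G : sgraph) (c : coloring G).
Implicit Types (b : bool) (S A : {set G}) (u v x y : G).

Definition colored b u v := adj u v && (c [set u; v] == b).

(** Both ends stay in [S] because distances are measured inside the subgraph. *)
Definition colored_in S b : rel G :=
  fun u v => [&& u \in S, v \in S & colored b u v].

Lemma colored_sym b u v : colored b u v = colored b v u.
Proof. by rewrite /colored adj_sym setUC. Qed.

Lemma colored_in_sym S b : symmetric (colored_in S b).
Proof. by move=> u v; rewrite /colored_in colored_sym andbCA. Qed.

Definition eqcolored S b := loops (colored_in S b).

Lemma eqcolored_refl S b : reflexive (eqcolored S b).
Proof. by move=> u; rewrite /eqcolored /loops eqxx. Qed.

Lemma eqcolored_sym S b : symmetric (eqcolored S b).
Proof. by move=> u v; rewrite /eqcolored /loops eq_sym colored_in_sym. Qed.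

Lemma eqcolored_total S u v : u \in S -> v \in S -> (u != v -> adj u v) ->
  eqcolored S true u v || eqcolored S false u v.
Proof.
move=> uS vS; rewrite /eqcolored /loops /colored_in /colored uS vS /=.
by case: eqP => //= _ ->; case: (c _).
Qed.

Definition mono_spans b S := spans3 (eqcolored S b) S.

Lemma mono_spans_subgraph b S : S != set0 -> mono_spans b S ->
  exists H : subgraph G,
    [/\ monochromatic c H, diameter_le H 3 & sub_vert H = S].
Proof.
move=> S0 spanS.
have adjP u v : colored_in S b u v -> [/\ u \in S, v \in S & adj u v].
  by case/and3P=> -> -> /andP[].
pose H := Subgraph S0 (@colored_in_sym S b) adjP.
exists H; split=> //; first by exists b => u v /and3P[_ _ /andP[_ /eqP]].
(* A decidable form of [dists_le]: [diameter_le] asks for the exact diameter, found as the least [d]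
   with [P d]. *)
pose P d := [forall u in S, forall v in S, walk (eqcolored S b) d u v].
have distP d : P d <-> dists_le H d.
  split=> [/forall_inP HP u v uS vS | HP].
    by apply/walk_loopsP; have/forall_inP := HP u uS; apply.
  by apply/forall_inP => u uS; apply/forall_inP => v vS; apply/walk_loopsP/HP.
have exP : exists d, P d by exists 3.
case: (ex_minnP exP) => d Pd mind; exists d; last exact: mind.
by split=> [|d' /distP]; [apply/distP | apply: mind].
Qed.

Lemma mono_spans_cover b1 b2 S1 S2 : S1 != set0 -> S2 != set0 ->
  mono_spans b1 S1 -> mono_spans b2 S2 -> S1 :|: S2 = [set: G] ->
  has_cover c 3 3.
Proof.
move=> S10 S20 /(mono_spans_subgraph S10)[H1 [mH1 dH1 vH1]].
move=> /(mono_spans_subgraph S20)[H2 [mH2 dH2 vH2]] cov.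
by exists H1, H2; rewrite vH1 vH2.
Qed.

Lemma mono_spans_star b u S : {in S, forall z, colored b u z} ->
  mono_spans b (u |: S).
Proof.
move=> uS; apply: (@double_star_spans3 _ _ _ u u) => [||| z].
- exact: eqcolored_refl.
- exact: eqcolored_sym.
- exact: eqcolored_refl.
rewrite orbb !inE /eqcolored /loops eq_sym => /predU1P[->|zS]; first by rewrite eqxx.
by rewrite /colored_in !inE eqxx zS uS // !orbT.
Qed.

Lemma mono_spans_clique S : clique S -> exists b, mono_spans b S.
Proof.
move=> cS; apply: spans3_complete => [||u v uS vS].
- exact: eqcolored_refl.
- exact: eqcolored_sym.
- by apply: eqcolored_total => //; apply: cS.
Qed.

Lemma mono_spans_two_cliques v x A :
    clique (v |: A) -> clique (x |: A) -> v \notin A -> x \notin A ->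
  (exists b, mono_spans b ([set v; x] :|: A)) \/
  (exists b, {in A, forall a, colored b v a && colored (~~ b) x a}).
Proof.
move=> cv cx vA xA; set W := _ :|: A.
have AW u : u \in A -> u \in W by move=> uA; rewrite !inE uA orbT.
have vW : v \in W by rewrite !inE eqxx.
have xW : x \in W by rewrite !inE eqxx orbT.
have tA : {in A &, forall p q, eqcolored W true p q || eqcolored W false p q}.
  move=> p q pA qA; apply: eqcolored_total (AW p pA) (AW q qA) _.
  by apply: cv; rewrite !inE ?pA ?qA orbT.
have [|||[b sb]|[b /forall_inP ob]] :=
  @spans3_almost_complete _ (eqcolored W) _ _ A tA v x.
- exact: eqcolored_refl.
- exact: eqcolored_sym.
- by split=> a aA; apply: eqcolored_total (AW a aA) _ => //; [apply: cv|apply: cx];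
    rewrite !inE ?eqxx ?aA ?orbT.
- by left; exists b.
right; exists b => a aA; have := ob a aA; rewrite /eqcolored /loops.
(* As [v] and [x] lie outside [A], the loops drop out and genuine edges remain. *)
have /negPf-> : v != a by apply: contraNneq vA => ->.
have /negPf-> : x != a by apply: contraNneq xA => ->.
by rewrite /colored_in (AW a aA) vW xW.
Qed.

(** The parts [v], [A], [x], [y], [B] are joined cyclically. If one color spans the side of [x] or
    of [y] together with [v], the rest lies in a clique; otherwise both sides show the pattern and
    stars suffice. *)
Lemma pentagon_cover v x y A B :
    clique (v |: A) -> clique (x |: A) -> clique (v |: B) -> clique (y |: B) ->
    v \notin A -> x \notin A -> v \notin B -> y \notin B -> adj x y ->
    (forall u, [|| u == v, u == x, u == y, u \in A | u \in B]) ->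
  has_cover c 3 3.
Proof.
move=> cvA cxA cvB cyB vA xA vB yB axy cov.
have U1_neq0 u S : u |: S != set0 by apply/set0Pn; exists u; rewrite !inE eqxx.
have covE S1 S2 : (forall u,
    [|| u == v, u == x, u == y, u \in A | u \in B] ==> (u \in S1 :|: S2)) ->
    S1 :|: S2 = [set: G].
  by move=> H; apply/setP => u; rewrite [RHS]inE; move/implyP: (H u); apply.
have [[b sb]|[b oA]] := mono_spans_two_cliques cvA cxA vA xA.
  have [b' sb'] := mono_spans_clique cyB.
  apply: (mono_spans_cover _ _ sb sb'); rewrite -?setUA ?U1_neq0 //.
  by apply: covE => u; rewrite !inE; do !case: (_ == _); do !case: (u \in _).
have [[b' sb']|[b' oB]] := mono_spans_two_cliques cvB cyB vB yB.
  have [b2 sb2] := mono_spans_clique cxA.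
  apply: (mono_spans_cover _ _ sb' sb2); rewrite -?setUA ?U1_neq0 //.
  by apply: covE => u; rewrite !inE; do !case: (_ == _); do !case: (u \in _).
have star d1 d2 u1 u2 S1 S2 :
    {in S1, forall z, colored d1 u1 z} -> {in S2, forall z, colored d2 u2 z} ->
    (forall u, [|| u == v, u == x, u == y, u \in A | u \in B] ==>
       (u \in (u1 |: S1) :|: (u2 |: S2))) -> has_cover c 3 3.
  move=> /mono_spans_star s1 /mono_spans_star s2 /covE.
  exact: mono_spans_cover s1 s2.
have vAb : {in A, forall a, colored b v a} by move=> a /oA/andP[].
have xAb : {in A, forall a, colored (~~ b) x a} by move=> a /oA/andP[].
have vBb : {in B, forall a, colored b' v a} by move=> a /oB/andP[].
have yBb : {in B, forall a, colored (~~ b') y a} by move=> a /oB/andP[].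
have xyc : colored (c [set x; y]) x y by rewrite /colored axy /=.
(* With equal colors, [v] is the center of a star on [A] and [B], and the edge [xy] covers the
   rest. *)
have [bb'|bb'] := eqVneq b' b.
  apply: (star b (c [set x; y]) v x (A :|: B) [set y]) => [z|z|u].
  - by rewrite inE => /orP[/vAb|/vBb] //; rewrite bb'.
  - by rewrite inE => /eqP->.
  - by rewrite !inE; do !case: (_ == _); do !case: (u \in _).
(* Now [y] sees [B] in color [b] and [x] sees [A] in [~~ b]. The edge [xy] extends one of these
   stars, and the star at [v] covers the other side. *)
have {}bb' : b' = ~~ b by case: b b' bb' {oA oB vAb xAb vBb yBb} => [] [].
have [cxy|cxy] := eqVneq (c [set x; y]) b.
  apply: (star b b y v (x |: B) A) => [z||u] //.
    rewrite !inE => /predU1P[->|/yBb]; last by rewrite bb' negbK.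
    by rewrite colored_sym -{1}cxy.
  by rewrite !inE; do !case: (_ == _); do !case: (u \in _).
apply: (star (~~ b) (~~ b) x v (y |: A) B) => [z||u].
- rewrite !inE => /predU1P[->|/xAb //].
  by move: cxy xyc; case: (c _) b {oA oB vAb xAb vBb yBb bb'} => [] [].
- by move=> z /vBb; rewrite bb'.
- by rewrite !inE; do !case: (_ == _); do !case: (u \in _).
Qed.

End Coloring.

(** * Independence number, cliques and the theorem *)

Lemma not_adj_adj (G : sgraph) (v x y : G) : independence_number G = 2 ->
  v != x -> v != y -> x != y -> ~~ adj v x -> ~~ adj v y -> adj x y.
Proof.
move=> alphaG vx vy xy nvx nvy; apply/idPn => nxy.
suff : 3 <= independence_number G by rewrite alphaG.
have <- : #|[set v; x; y]| = 3.
  by rewrite -setUA !cardsU1 cards1 !inE (negPf vx) (negPf vy) xy.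
apply: (leq_bigmax_cond (F := fun S : {set G} => #|S|)).
apply/forall_inP => p pS; apply/forall_inP => q qS; move: pS qS.
by rewrite !inE -!orbA => /or3P[]/eqP-> /or3P[]/eqP->;
  rewrite ?adj_irr // adj_sym.
Qed.

Lemma clique_sub (G : sgraph) (A B : {set G}) :
  A \subset B -> clique B -> clique A.
Proof. by move=> /subsetP AB cB x y /AB xB /AB; apply: cB. Qed.

Lemma clique_setU1 (G : sgraph) (v : G) (A : {set G}) :
  clique A -> {in A, forall a, adj v a} -> clique (v |: A).
Proof.
move=> cA va p q; rewrite !inE => /predU1P[->|pA] /predU1P[->|qA].
- by rewrite eqxx.
- by rewrite va.
- by rewrite adj_sym va.
- exact: cA.
Qed.

Theorem theorem2p2 (G : sgraph) (c : coloring G)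
  (alphaG : independence_number G = 2)
  (v : G) (K' K'' : {set G})
  (cliqueK' : clique K') (cliqueK'' : clique K'')
  (disjK : [disjoint K' & K''])
  (coverK : K' :|: K'' = [set: G] :\ v)
  (vK' : #|[set x in K' | ~~ adj v x]| = 1)
  (vK'' : #|[set x in K'' | ~~ adj v x]| = 1) :
  has_cover c 3 3.
Proof.
have inK u : (u \in K') || (u \in K'') = (u != v).
  by rewrite -in_setU coverK !inE andbT.
have /norP[vnK' vnK''] : ~~ ((v \in K') || (v \in K'')) by rewrite inK eqxx.
have split_off K : clique K -> v \notin K ->
    #|[set x in K | ~~ adj v x]| = 1 ->
    exists x, [/\ x \in K, ~~ adj v x & clique (v |: K :\ x)].
  move=> cK vK /eqP/cards1P[x xE]; exists x.
  have /setP/(_ x) := xE; rewrite !inE eqxx => /andP[xK nvx]; split=> //.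
  apply: clique_setU1; first exact: clique_sub (subsetDl _ _) cK.
  move=> a; rewrite !inE => /andP[ax aK].
  by have /setP/(_ a) := xE; rewrite !inE aK (negPf ax) => /negbFE.
have [x [xK nvx cvA]] := split_off _ cliqueK' vnK' vK'.
have [y [yK nvy cvB]] := split_off _ cliqueK'' vnK'' vK''.
have xy : x != y by apply: contraTneq yK => <-; rewrite (disjointFr disjK xK).
(* Here [A] is [K' :\ x] and [B] is [K'' :\ y]; adding [x] and [y] back recovers the given
   cliques. *)
apply: (pentagon_cover c cvA _ cvB _ (x := x) (y := y));
  rewrite ?setD1K ?inE ?eqxx ?(negPf vnK') ?(negPf vnK'') ?andbF //.
- apply: not_adj_adj nvx nvy => //.
    by apply: contraNneq vnK' => ->.
  by apply: contraNneq vnK'' => ->.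
- move=> u; have := inK u; rewrite !inE.
  by do !case: (u == _) => //=; move=> ->.
Qed.
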